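(* Let $H\in(0,1)$, let $(a,b)\in\mathbb{R}^2\setminus\{(0,0)\}$, and let $Z^H=(Z_t^H(a,b))_{t\ge 0}$ be the generalized fractional Brownian motion with parameters $a,b,H$. Then $Z^H$ is a self-similar process.
   Context: For $H\in(0,1)$, a two-sided fractional Brownian motion with Hurst parameter $H$ is a centered Gaussian process $B^H=(B_t^H)_{t\in\mathbb{R}}$ on a probability space $(\Omega,F,\mathbb{P})$ with covariance $\operatorname{Cov}(B_t^H,B_s^H)=\frac12\bigl(|s|^{2H}+|t|^{2H}-|t-s|^{2H}\bigr)$ for $s,t\in\mathbb{R}$. For real $a,b$ with $(a,b)\ne(0,0)$, the generalized fractional Brownian motion (gfBm) with parameters $a,b,H$ is the process $Z^H=(Z_t^H)_{t\ge0}$ defined by $Z_t^H=Z_t^H(a,b)=aB_t^H+bB_{-t}^H$ for $t\ge 0$. A process $(X_t)_{t\ge0}$ is self-similar if there is $\kappa>0$ such that for every $h>0$ the processes $(X_{ht})_{t\ge0}$ and $(h^{\kappa}X_t)_{t\ge0}$ have the same finite-dimensional distributions. *)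

(* Defs.v *)
From HB Require Import structures.
From mathcomp Require Import all_boot all_order all_algebra.
From mathcomp Require Import all_classical all_reals all_analysis.
From mathcomp Require Import measurable_realfun.

Set Implicit Arguments.
Unset Strict Implicit.
Unset Printing Implicit Defensive.

Import Order.TTheory GRing.Theory Num.Theory.
Import numFieldNormedType.Exports.

Local Open Scope classical_set_scope.
Local Open Scope ring_scope.

(* A stochastic process indexed by [I] is a family [X : I -> {RV P >-> R}]. *)

(* [s] is the standard deviation. The degenerate case is spelled out because
   the library's [normal_prob m 0] is the uniform law on [0, 1], not the Dirac
   mass at [m]. *)
Definition gaussian_law (R : realType) (m s : R) : set R -> \bar R :=
  if s == 0 then \d_m else normal_prob m s.

Definition gaussian_rv (d : measure_display) (T : measurableType d)
    (R : realType) (P : probability T R) (X : {RV P >-> R}) : Prop :=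
  exists m s : R, 0 <= s /\
    forall A : set R, measurable A -> distribution P X A = gaussian_law m s A.
Arguments gaussian_rv {d T R} P X.

(* Jointly Gaussian finite-dimensional marginals, expressed by linear
   combinations (the times [t i] may repeat). *)
Definition gaussian_process (d : measure_display) (T : measurableType d)
    (R : realType) (P : probability T R) (I : Type)
    (X : I -> {RV P >-> R}) : Prop :=
  forall (n : nat) (t : 'I_n -> I) (c : 'I_n -> R),
    gaussian_rv P (\sum_(i < n) c i *: X (t i) : {RV P >-> R}).
Arguments gaussian_process {d T R} P {I} X.

Definition centered (d : measure_display) (T : measurableType d)
    (R : realType) (P : probability T R) (I : Type)
    (X : I -> {RV P >-> R}) : Prop :=
  forall t : I, ('E_P[X t] = 0)%E.
Arguments centered {d T R} P {I} X.

Definition fractional_brownian_motion (d : measure_display)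
    (T : measurableType d) (R : realType) (P : probability T R) (H : R)
    (B : R -> {RV P >-> R}) : Prop :=
  [/\ gaussian_process P B, centered P B &
      forall t s : R, covariance P (B t) (B s) =
        (2^-1 * (`|s| `^ (2 * H) + `|t| `^ (2 * H) - `|t - s| `^ (2 * H)))%:E].
Arguments fractional_brownian_motion {d T R} P H B.

Definition gfBm (d : measure_display) (T : measurableType d)
    (R : realType) (P : probability T R) (a b : R)
    (B : R -> {RV P >-> R}) (t : {nonneg R}) : {RV P >-> R} :=
  a *: B t%:num + b *: B (- t%:num).
Arguments gfBm {d T R} P a b B t.

Section joint.
Context (d : measure_display) (T : measurableType d) (R : realType)
  (P : probability T R) (I : Type) (X : I -> {RV P >-> R})
  (n : nat) (t : 'I_n -> I).

Definition joint (w : T) : n.-tuple R := [tuple X (t i) w | i < n].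

Let measurable_joint : measurable_fun [set: T] joint.
Proof.
apply/measurable_fun_tnthP => i.
rewrite (_ : _ \o _ = X (t i) :> (T -> R)); first exact: measurable_funP.
by apply/funext => w /=; rewrite tnth_mktuple.
Qed.

HB.instance Definition _ := isMeasurableFun.Build _ _ _ _ joint measurable_joint.

End joint.
Arguments joint {d T R} P {I} X {n} t w.

(* Measurable sets of [n.-tuple R] are those of the product sigma-algebra. *)
Definition same_fdd (d : measure_display) (T : measurableType d)
    (R : realType) (P : probability T R) (I : Type)
    (X Y : I -> {RV P >-> R}) : Prop :=
  forall (n : nat) (t : 'I_n -> I) (A : set (n.-tuple R)), measurable A ->
    distribution P (joint P X t) A = distribution P (joint P Y t) A.
Arguments same_fdd {d T R} P {I} X Y.

Definition self_similar (d : measure_display) (T : measurableType d)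
    (R : realType) (P : probability T R) (X : {nonneg R} -> {RV P >-> R})
    : Prop :=
  exists2 kappa : R, 0 < kappa & forall h : {posnum R},
    same_fdd P (fun t : {nonneg R} => X (h%:num * t%:num)%:nng)
               (fun t : {nonneg R} => h%:num `^ kappa *: X t).
Arguments self_similar {d T R} P X.

(* Main.v *)
(* With kappa = H, the processes Z_(ht) and h^H Z_t are centered Gaussian with
   the same covariance. That this determines the finite-dimensional laws rests
   on two facts. First, a centered Gaussian law on the line is determined by its
   variance: it is the image of the standard normal law under
   y |-> s (y - std_mean), and the variance of the standard normal law, whatever
   its value, is positive. Second, by the Cramer-Wold principle a probability on
   R^n is determined by its integrals of the functions x |-> cos (c . x + e):
   their span is an algebra, and its closure under bounded pointwise limits
   contains the indicator of every measurable set. *)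
Require Import Defs.
From HB Require Import structures.
From mathcomp Require Import all_boot all_order all_algebra.
From mathcomp Require Import all_classical all_reals all_analysis.
From mathcomp Require Import measurable_realfun ring lra.

Set Implicit Arguments.
Unset Strict Implicit.
Unset Printing Implicit Defensive.

Import Order.TTheory GRing.Theory Num.Theory.
Import numFieldNormedType.Exports.

Local Open Scope classical_set_scope.
Local Open Scope ring_scope.

(** * Plane waves, their span closed under bounded limits, and integrals *)

Section trig_closure.
Context (R : realType) (n : nat).
Implicit Types (f g : n.-tuple R -> R) (A : set (n.-tuple R)).

Definition plane_wave (c : 'I_n -> R) (d : R) (x : n.-tuple R) : R :=
  cos (\sum_(i < n) c i * tnth x i + d).

(** The bound [M] is uniform in [k] and [x], so dominated convergence covers the limit rule.
    Products are not a constructor: equality of integrals under two laws passes through sums,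
    scalings and such limits, but not through products, which [trigM] recovers afterwards. *)
Inductive trig_closure : (n.-tuple R -> R) -> Prop :=
| trig_wave c d : trig_closure (plane_wave c d)
| trigD f g : trig_closure f -> trig_closure g ->
    trig_closure (fun x => f x + g x)
| trigZ (a : R) f : trig_closure f -> trig_closure (fun x => a * f x)
| trig_lim (f_ : nat -> n.-tuple R -> R) f (M : R) :
    (forall k, trig_closure (f_ k)) -> (forall k x, `|f_ k x| <= M) ->
    (forall x, f_ k x @[k --> \oo] --> f x) -> trig_closure f.

Lemma cos_norm_le1 (x : R) : `|cos x| <= 1.
Proof. by rewrite ler_norml cos_geN1 cos_le1. Qed.

Lemma trig_closure_bounded f :
  trig_closure f -> exists M, forall x, `|f x| <= M.
Proof.
elim=> [c d|{}f g _ [M fM] _ [N gN]|a {}f _ [M fM]|f_ {}f M _ _ fM ff].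
- by exists 1 => x; exact: cos_norm_le1.
- by exists (M + N) => x; rewrite (le_trans (ler_normD _ _))// lerD.
- by exists (`|a| * M) => x; rewrite normrM ler_wpM2l.
- exists M => x; apply: (ler_cvg_to (cvg_norm (ff x)) (cvg_cst M)).
  by apply: nearW => k; exact: fM.
Qed.

Lemma measurable_trig_closure f :
  trig_closure f -> measurable_fun [set: n.-tuple R] f.
Proof.
elim=> [c d|{}f g _ mf _ mg|a {}f _ mf|f_ {}f M _ mf _ ff].
- rewrite /plane_wave; apply: measurableT_comp.
    by apply: continuous_measurable_fun; exact: continuous_cos.
  apply: measurable_funD => //; apply: measurable_sum => i.
  by apply: measurable_funM => //; exact: measurable_tnth.
- exact: measurable_funD.
- exact: measurable_funM.
- by apply: (measurable_fun_cvg mf) => x _; exact: ff.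
Qed.

Lemma trig_closure_integrable (P : probability (n.-tuple R) R) f :
  trig_closure f -> P.-integrable setT (EFin \o f).
Proof.
move=> tf; apply: measurable_bounded_integrable => //.
- by rewrite ltey_eq fin_num_measure.
- exact: measurable_trig_closure.
- have [M fM] := trig_closure_bounded tf.
  exists M; split=> [|N MN x _]; first exact: num_real.
  by rewrite /= (le_trans (fM x))// ltW.
Qed.

Lemma eq_integral_trig_closure (P Q : probability (n.-tuple R) R) :
    (forall c d, (\int[P]_x (plane_wave c d x)%:E =
                  \int[Q]_x (plane_wave c d x)%:E)%E) ->
  forall f, trig_closure f ->
  (\int[P]_x (f x)%:E = \int[Q]_x (f x)%:E)%E.
Proof.
move=> PQ f; elim=> [//|{}f g tf PQf tg PQg|a {}f tf PQf|f_ {}f M tf PQf fM ff].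
- have intD (S : probability (n.-tuple R) R) :
      (\int[S]_x (f x + g x)%:E = \int[S]_x (f x)%:E + \int[S]_x (g x)%:E)%E.
    by apply: integralD_EFin; [|exact: trig_closure_integrable..].
  by rewrite !intD PQf PQg.
- have intZ (S : probability (n.-tuple R) R) :
      (\int[S]_x (a * f x)%:E = a%:E * \int[S]_x (f x)%:E)%E.
    by rewrite -integralZl//; exact: trig_closure_integrable.
  by rewrite !intZ PQf.
- have cvg_int (S : probability (n.-tuple R) R) :
      (\int[S]_x (f_ k x)%:E @[k --> \oo] --> \int[S]_x (f x)%:E)%E.
    have mE g : trig_closure g -> measurable_fun setT (fun x => (g x)%:E).
      by move=> tg; apply/measurable_EFinP; exact: measurable_trig_closure.
    have [| | | | |//] := @dominated_convergence _ _ _ S setT measurableT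
      (fun k x => (f_ k x)%:E) (fun x => (f x)%:E) (fun=> M%:E).
    + by move=> k; exact: mE.
    + by apply: mE; exact: (trig_lim tf fM ff).
    + by apply: aeW => x _; apply: cvg_EFin; [exact: nearW|exact: ff].
    + exact: (finite_measure_integrable_cst S M).
    + by apply: aeW => x k _; rewrite lee_fin; exact: fM.
  apply/esym; move: (cvg_int P); under eq_fun do rewrite PQf.
  by move=> /(cvg_unique _ (cvg_int Q))->.
Qed.

(** The product-to-sum formula turns a product of two waves into half the sum of two waves; the
    other constructors are compatible with multiplication by a fixed bounded function. *)
Lemma trig_closure_mul_wave f c d :
  trig_closure f -> trig_closure (fun x => f x * plane_wave c d x).
Proof.
elim=> [c' d'|{}f g _ tf _ tg|a {}f _ tf|f_ {}f M _ tf fM ff].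
- suff -> : (fun x => plane_wave c' d' x * plane_wave c d x) =
      (fun x => 2^-1 * (plane_wave (fun i => c' i + c i) (d' + d) x +
                       plane_wave (fun i => c' i - c i) (d' - d) x)).
    by apply/trigZ/trigD; exact: trig_wave.
  apply/funext => x; rewrite /plane_wave.
  set s := \sum_(i < n) c i * _; set s' := \sum_(i < n) c' i * _.
  have -> : \sum_(i < n) (c' i + c i) * tnth x i + (d' + d) =
      (s' + d') + (s + d).
    by under eq_bigr do rewrite mulrDl; rewrite big_split/= addrACA.
  have -> : \sum_(i < n) (c' i - c i) * tnth x i + (d' - d) =
      (s' + d') - (s + d).
    by under eq_bigr do rewrite mulrBl; rewrite sumrB opprD addrACA.
  by rewrite (cosD (s' + d')) (cosB (s' + d')); field.
- rewrite (_ : (fun _ => _) =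
    fun x => f x * plane_wave c d x + g x * plane_wave c d x).
    exact: trigD.
  by apply/funext => x; rewrite mulrDl.
- rewrite (_ : (fun _ => _) = fun x => a * (f x * plane_wave c d x)).
    exact: trigZ.
  by apply/funext => x; rewrite mulrA.
- apply: (trig_lim tf (M := M)) => [k x|x].
    by rewrite normrM -[M]mulr1 ler_pM// cos_norm_le1.
  by apply: cvgM; [exact: ff|exact: cvg_cst].
Qed.

(** A second induction, now on [g], with the previous lemma as base case; in the limit case the
    boundedness of [f] supplies the uniform bound. *)
Lemma trigM f g :
  trig_closure f -> trig_closure g -> trig_closure (fun x => f x * g x).
Proof.
move=> tf; elim=> [c d|{}g h _ tg _ th|a {}g _ tg|g_ {}g M _ tg gM gg].
- exact: trig_closure_mul_wave.
- rewrite (_ : (fun _ => _) = fun x => f x * g x + f x * h x).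
    exact: trigD.
  by apply/funext => x; rewrite mulrDr.
- rewrite (_ : (fun _ => _) = fun x => a * (f x * g x)).
    exact: trigZ.
  by apply/funext => x; rewrite mulrCA.
- have [N fN] := trig_closure_bounded tf.
  apply: (trig_lim tg (M := N * M)) => [k x|x].
    by rewrite normrM ler_pM.
  by apply: cvgM; [exact: cvg_cst|exact: gg].
Qed.

Lemma trig_cst (a : R) : trig_closure (fun=> a).
Proof.
rewrite (_ : (fun=> a) = fun x => a * plane_wave (fun=> 0) 0 x).
  exact/trigZ/trig_wave.
apply/funext => x; rewrite /plane_wave big1 ?addr0 ?cos0 ?mulr1// => i _.
by rewrite mul0r.
Qed.

Lemma trigB f g :
  trig_closure f -> trig_closure g -> trig_closure (fun x => f x - g x).
Proof.
move=> tf tg; rewrite (_ : (fun _ => _) = fun x => f x + (-1) * g x).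
  exact/trigD/trigZ.
by apply/funext => x; rewrite mulN1r.
Qed.

(* Its iterates converge to the sign function on [-1, 1] and are polynomials, so
   they stay in the algebra. *)
Let smoothsign (v : R) := v * (3 - v ^+ 2) / 2.

(** Writing S for [smoothsign]: S(v) - v = v (1 - v) (1 + v) / 2 and 1 - S(v) = (1 - v)^2 (2 + v) /
    2, both nonnegative on ]0, 1]. *)
Let smoothsign_itv v : 0 < v <= 1 -> v <= smoothsign v <= 1.
Proof.
move=> /andP[v0 v1]; rewrite /smoothsign; apply/andP; split.
  have : 0 <= v * (1 - v) * (1 + v) by rewrite !mulr_ge0//; lra.
  by nra.
have : 0 <= (1 - v) ^+ 2 * (2 + v) by rewrite mulr_ge0 ?sqr_ge0//; lra.
by nra.
Qed.

Let smoothsignN v : smoothsign (- v) = - smoothsign v.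
Proof. by rewrite /smoothsign sqrrN mulNr mulNr. Qed.

Let iter_smoothsignN k v : iter k smoothsign (- v) = - iter k smoothsign v.
Proof. by elim: k => //= k ->; rewrite smoothsignN. Qed.

Let iter_smoothsign0 k : iter k smoothsign 0 = 0.
Proof. by elim: k => //= k ->; rewrite /smoothsign !mul0r. Qed.

Let iter_smoothsign_itv k v : 0 < v <= 1 -> v <= iter k smoothsign v <= 1.
Proof.
move=> v01; elim: k => [|k /andP[vk k1]] /=.
  by rewrite lexx; case/andP: v01.
have /andP[kS ->] :
    iter k smoothsign v <= smoothsign (iter k smoothsign v) <= 1.
  by apply: smoothsign_itv; rewrite k1 (lt_le_trans _ vk)//; case/andP: v01.
by rewrite (le_trans vk kS).
Qed.

(** Each step multiplies the distance from w to the fixed point 1 by 1 - (w + w^2) / 2; since the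
    iterate w stays at least v, this factor is at most 1 - v / 2. *)
Let iter_smoothsign_dist k v :
  0 < v <= 1 -> 1 - iter k smoothsign v <= (1 - v / 2) ^+ k.
Proof.
move=> v01; have /andP[v0 v1] := v01; elim: k => [|k IH] /=.
  by rewrite expr0; lra.
have /andP[vk k1] := iter_smoothsign_itv k v01.
rewrite exprS; set w := iter k _ _ in IH vk k1 *.
have -> : 1 - smoothsign w = (1 - (w + w ^+ 2) / 2) * (1 - w).
  by rewrite /smoothsign; field.
rewrite ler_pM//; [|lra|]; first by nra.
by nra.
Qed.

Let cvg_iter_smoothsign v : `|v| <= 1 ->
  iter k smoothsign v @[k --> \oo] --> Num.sg v.
Proof.
have pos u : 0 < u <= 1 -> iter k smoothsign u @[k --> \oo] --> (1 : R).
  move=> u01; have /andP[u0 u1] := u01.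
  apply/cvgrPdist_le => e e0.
  have /cvgrPdist_le/(_ _ e0) : (1 - u / 2) ^+ k @[k --> \oo] --> (0 : R).
    by apply: cvg_expr; rewrite ger0_norm; lra.
  apply: filterS => k; rewrite sub0r normrN; apply: le_trans.
  have /andP[vk k1] := iter_smoothsign_itv k u01.
  rewrite !ger0_norm ?subr_ge0 ?exprn_ge0//; last by lra.
  exact: iter_smoothsign_dist.
move=> v1; case: sgrP v1 => [->|v0|v0].
- by move=> _; under eq_fun do rewrite iter_smoothsign0; exact: cvg_cst.
- by move=> v1; apply: pos; rewrite v0.
- move=> v1; rewrite -[v]opprK; under eq_fun do rewrite iter_smoothsignN.
  by apply: cvgN; apply: pos; rewrite oppr_gt0 v0.
Qed.

Let iter_smoothsign_le1 k v : `|v| <= 1 -> `|iter k smoothsign v| <= 1.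
Proof.
move=> v1; have [v0|v0|->] := ltgtP v 0.
- rewrite -[v]opprK iter_smoothsignN normrN.
  have v01 : 0 < - v <= 1 by rewrite oppr_gt0 v0 -(ltr0_norm v0).
  have /andP[vk k1] := iter_smoothsign_itv k v01.
  by rewrite ger0_norm// (le_trans _ vk)//; case/andP: v01 => /ltW.
- have v01 : 0 < v <= 1 by rewrite v0 -(gtr0_norm v0).
  have /andP[vk k1] := iter_smoothsign_itv k v01.
  by rewrite ger0_norm// (le_trans _ vk)//; exact: ltW.
- by rewrite iter_smoothsign0 normr0.
Qed.

(** The bound on [f] keeps its values in [-1, 1], where the iteration converges and stays bounded by
    1. *)
Lemma trig_sg f : trig_closure f -> (forall x, `|f x| <= 1) ->
  trig_closure (fun x => Num.sg (f x)).
Proof.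
move=> tf f1; apply: (@trig_lim (fun k x => iter k smoothsign (f x)) _ 1).
- elim=> [//|k IH] /=; rewrite /smoothsign.
  rewrite (_ : (fun _ => _) = fun x => 2^-1 * (iter k smoothsign (f x) *
      (3 - (iter k smoothsign (f x)) * (iter k smoothsign (f x))))).
    by apply/trigZ/trigM => //; apply: trigB; [exact: trig_cst|exact: trigM].
  by apply/funext => x; rewrite mulrC -expr2.
- by move=> k x; exact: iter_smoothsign_le1.
- by move=> x; exact: cvg_iter_smoothsign.
Qed.

(** * From signs of coordinates to indicators of measurable sets *)

Lemma trig_sin_tnth (i : 'I_n) (a d : R) :
  trig_closure (fun x => sin (a * (tnth x i - d))).
Proof.
rewrite (_ : (fun _ => _) =
  (* The phase shift by -pi/2 turns the cosine into a sine. *)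
  plane_wave (fun j => if j == i then a else 0) (- (a * d) - pi / 2)).
  exact: trig_wave.
apply/funext => x; rewrite /plane_wave (bigD1 i)//= eqxx big1 ?addr0.
  by rewrite addrA cosBpihalf mulrBr.
by move=> j /negbTE ->; rewrite mul0r.
Qed.

Lemma sg_sin (x : R) : `|x| < pi -> Num.sg (sin x) = Num.sg x.
Proof.
have pos (y : R) : 0 < y -> `|y| < pi -> Num.sg (sin y) = Num.sg y.
  by move=> y0; rewrite gtr0_norm// => ypi; rewrite !gtr0_sg// sin_gt0_pi ?y0.
move=> xpi; have [x0|x0|->] := ltgtP x 0; last by rewrite sin0.
- rewrite -[x]opprK sinN !(@sgrN _ (_ _)) sgrN pos// ?sgrN ?oppr_gt0//.
  by rewrite normrN.
- exact: pos.
Qed.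

(** Coordinates are unbounded, so [trig_sg] does not apply to them directly. Instead sin ((x_i - d)
    / (k + 1)) lies in the closure and has the sign of x_i - d as soon as |x_i - d| < (k + 1) pi. *)
Lemma trig_sg_tnth (i : 'I_n) (d : R) :
  trig_closure (fun x => Num.sg (tnth x i - d)).
Proof.
apply: (@trig_lim (fun k x => Num.sg (sin (k.+1%:R^-1 * (tnth x i - d)))) _ 1).
- move=> k; apply: trig_sg; first exact: trig_sin_tnth.
  by move=> x; rewrite ler_norml sin_geN1 sin_le1.
- by move=> k x; rewrite normr_sg lern1 leq_b1.
- move=> x; apply: cvg_near_cst.
  have pi0 := pi_gt0 R.
  near=> k.
  have k0 : 0 < k.+1%:R^-1 :> R by rewrite invr_gt0.
  rewrite sg_sin.
    by rewrite sgrM gtr0_sg// mul1r.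
  rewrite normrM gtr0_norm// mulrC ltr_pdivrMr// -ltr_pdivrMl//.
  have : pi^-1 * `|tnth x i - d| < k%:R by near: k; exact: nbhs_infty_gtr.
  by move=> /lt_trans; apply; rewrite ltr_nat.
Unshelve. all: by end_near. Qed.

Lemma trig_indic_ray (i : 'I_n) (d : R) :
  trig_closure (\1_((fun x => tnth x i) @^-1` `]d, +oo[)).
Proof.
pose s := fun x : n.-tuple R => Num.sg (tnth x i - d).
(* (s + s^2) / 2 is 1 at s = 1 and 0 at s = 0 and s = -1. *)
rewrite (_ : \1_ _ = fun x => 2^-1 * (s x + s x * s x)).
  have ts : trig_closure s by exact: trig_sg_tnth.
  by apply/trigZ/trigD => //; exact: trigM.
apply/funext => x; rewrite indicE /s; case: sgrP => [/eqP|xd|xd].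
- rewrite subr_eq0 => /eqP xd; rewrite memNset/=; last first.
    by rewrite in_itv/= xd ltxx.
  by rewrite mulr0 addr0 mulr0.
- rewrite mem_set/=; last by rewrite in_itv/= andbT -subr_gt0.
  by field.
- rewrite memNset/=; last by rewrite in_itv/= andbT -subr_gt0 => ?; lra.
  by field.
Qed.

Lemma sigma_algebra_trig_indic :
  sigma_algebra setT [set A | trig_closure (\1_A)].
Proof.
split=> [|A /= tA|F /= tF].
- by rewrite /= indic0; exact: trig_cst.
- rewrite (_ : \1_ _ = fun x => 1 - \1_A x).
    by apply: trigB => //; exact: trig_cst.
  apply/funext => x; rewrite setTD indicC indicE.
  by case: (x \in A); rewrite ?subrr ?subr0.
(* 1 - [f k] is the indicator of the union of the first k sets; at each point it is eventually
   constant in k, equal to the indicator of the whole union. *)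
- pose f k x : R := \prod_(i < k) (1 - \1_(F i) x).
  have f01 k x : 0 <= f k x <= 1.
    apply: (big_ind (fun y : R => 0 <= y <= 1)) => [|y z|i _].
    + by rewrite ler01 lexx.
    + by move=> /andP[y0 y1] /andP[z0 z1]; rewrite mulr_ge0//= mulr_ile1.
    + by rewrite indicE; case: (_ \in _); rewrite ?subrr ?subr0 lexx ler01.
  apply: (@trig_lim (fun k x => 1 - f k x) _ 1).
  + move=> k; apply: trigB; first exact: trig_cst.
    rewrite /f; elim: k => [|k IH].
      by under eq_fun do rewrite big_ord0; exact: trig_cst.
    under eq_fun do rewrite big_ord_recr/=.
    by apply: trigM => //; apply: trigB => //; exact: trig_cst.
  + move=> k x; have /andP[f0 f1] := f01 k x.
    by rewrite ger0_norm; lra.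
  + move=> x; apply: cvg_near_cst; rewrite indicE.
    have [/set_mem[j _ Fj]|/negP Fx] := boolP (x \in _).
      near=> k.
      have jk : (j < k)%N by near: k; exact: nbhs_infty_gt.
      by rewrite /f (bigD1 (Ordinal jk))//= indicE mem_set// subrr mul0r subr0.
    near=> k.
    rewrite /f big1 ?subrr// => i _; rewrite indicE memNset ?subr0// => Fix.
    by apply: Fx; rewrite inE; exists i.
Unshelve. all: by end_near. Qed.

(** The product sigma-algebra is generated by coordinate preimages of Borel sets, and the Borel sets
    by open rays. For the second generation, the sigma-algebra of good sets is pushed forward along
    a coordinate. *)
Lemma trig_indic A : measurable A -> trig_closure (\1_A).
Proof.
apply: (@smallest_sub _ _ _ [set B | trig_closure (\1_B)]).
  exact: sigma_algebra_trig_indic.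
apply: (big_ind (fun G => G `<=` [set B | trig_closure (\1_B)])) => //.
  by move=> G G' tG tG' B [/tG|/tG'].
move=> i _ _ [C mC <-]; rewrite setTI; move: C mC.
pose G := [set C : set R | trig_closure (\1_((fun x => tnth x i) @^-1` C))].
suff GE : (@RGenOInfty.G R).-sigma.-measurable `<=` G.
  by move=> C mC; apply: GE; rewrite -RGenOInfty.measurableE.
apply: smallest_sub; last by move=> C [d ->]; exact: trig_indic_ray.
rewrite (_ : G = image_set_system setT (fun x => tnth x i)
                   [set B | trig_closure (\1_B)]).
  exact/sigma_algebra_image/sigma_algebra_trig_indic.
by apply/seteqP; split=> C; rewrite /G /image_set_system/= setTI.
Qed.

Lemma eq_probability_plane_wave (P Q : probability (n.-tuple R) R) :
    (forall c d, (\int[P]_x (plane_wave c d x)%:E =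
                  \int[Q]_x (plane_wave c d x)%:E)%E) ->
  forall A, measurable A -> P A = Q A.
Proof.
move=> PQ A mA; rewrite -[A]setIT -!integral_indic//.
exact/eq_integral_trig_closure/trig_indic.
Qed.

End trig_closure.

(** * Normal laws as affine images of the standard one *)

Lemma measurable_affine (R : realType) (m s : R) :
  measurable_fun [set: R] (fun y => m + s * y).
Proof. by apply: measurable_funD => //; exact: measurable_funM. Qed.

(** Substitute m + s x for the variable: the Jacobian s cancels the factor 1/s in the peak of the
    density. *)
Lemma normal_prob_ray (R : realType) (m s y : R) : 0 < s ->
  normal_prob m s `[m + s * y, +oo[ = normal_prob 0 1 `[y, +oo[.
Proof.
move=> s0; rewrite /normal_prob.
pose F (x : R^o) : R^o := m + s * x.
have F' : F^`()%classic = cst s.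
  apply/funext => x; rewrite /F derive1E deriveD// derive_cst add0r.
  by rewrite deriveM// derive_id derive_cst scaler0 addr0 /GRing.scale/= mulr1.
have dF x : derivable F x 1 by exact: derivableD.
have cF : continuous F.
  move=> x; apply: differentiable_continuous.
  by apply/derivable1_diffP; exact: dF.
rewrite (@increasing_ge0_integration_by_substitutiony _ F); last 8 first.
- by move=> x x' _ _ xx'; rewrite /F ltrD2l ltr_pM2l.
- by rewrite F' => x _; exact: cvg_cst.
- by rewrite F'; exact: is_cvg_cst.
- by rewrite F'; exact: is_cvg_cst.
- split; first by move=> x _; exact: dF.
  by apply: cvg_at_right_filter; exact: cF.
- apply: (cvg_comp (fun x : R => s * x) (fun x => m + x)).
    by apply: gt0_cvgMry => //; exact: cvg_id.
  exact: cvg_addrl.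
- apply: continuous_subspaceT => x.
  by apply: continuous_normal_pdf; rewrite gt_eqF.
- by move=> x _; exact: normal_pdf_ge0.
apply: eq_integral => x _; congr (_%:E); rewrite F' /=.
rewrite !normal_pdfE ?oner_eq0 ?gt_eqF// /normal_peak /normal_fun /F !fctE/=.
rewrite subr0 addrAC subrr add0r -!mulrnAr sqrtrM ?sqr_ge0//.
rewrite sqrtr_sqr gtr0_norm//.
rewrite expr1n !mul1r (_ : - (s * x) ^+ 2 / _ = - x ^+ 2 / 2); last first.
  by field; rewrite gt_eqF.
by rewrite invfM mulrC !mulrA divff ?mul1r// gt_eqF.
Qed.

(** The rays [x, +oo[ are stable under intersection, generate the Borel sets and exhaust the line,
    so agreement on them extends to all measurable sets. *)
Lemma normal_prob_affine (R : realType) (m s : R) (A : set R) :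
  0 < s -> measurable A ->
  normal_prob m s A = normal_prob 0 1 ((fun y => m + s * y) @^-1` A).
Proof.
move=> s0.
have mF : measurable_fun (@setT (measurableTypeR R))
    (fun y : measurableTypeR R => m + s * y : measurableTypeR R).
  exact: measurable_affine.
pose F := @mfun_Sub _ _ (measurableTypeR R) (measurableTypeR R) _ (mem_set mF).
apply: (@measure_unique _ R (measurableTypeR R) (@RGenCInfty.G R)
    (fun k => `[- k%:R, +oo[%classic) (@RGenCInfty.measurableE R) _ _ _
    (normal_prob m s) (distribution (normal_prob 0 1) F)) =>
    [_ _ [x ->] [y ->]|k| |_ [x ->]|k].
- exists (Num.max x y).
  by apply/seteqP; split=> z /=; rewrite !in_itv/= !andbT ge_max => /andP.
- by exists (- k%:R).
- apply/seteqP; split=> // x _.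
  have /filter_ex[k xk] := @nbhs_infty_ger R (- x).
  by exists k; rewrite //= in_itv/= andbT lerNl.
- have -> : x = m + s * ((x - m) / s) by field; rewrite gt_eqF.
  apply: (etrans (normal_prob_ray _ _ s0)).
  rewrite /distribution /pushforward/=; congr normal_prob.
  apply/seteqP; split=> z /=; rewrite !in_itv/= !andbT.
    by move=> ?; rewrite lerD2l ler_pM2l.
  by rewrite lerD2l ler_pM2l.
- by rewrite ltey_eq fin_num_measure.
Qed.

(** * The standard normal law and its variance *)

Lemma measurable_idR (R : realType) :
  @measurable_fun _ _ (measurableTypeR R) R setT idfun.
Proof. exact: measurable_id. Qed.

(* [normal_prob] is typed on the alias [measurableTypeR R]; this is the same
   measure on [R] itself. *)
Definition std_normal (R : realType) : probability R R :=
  distribution (normal_prob 0 1)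
    (@mfun_Sub _ _ (measurableTypeR R) R _ (mem_set (@measurable_idR R))).

Lemma std_normalE (R : realType) (A : set R) :
  std_normal R A = normal_prob 0 1 A.
Proof. by []. Qed.

Lemma std_normal_set1 (R : realType) (x : R) : std_normal R [set x] = 0%E.
Proof.
rewrite std_normalE.
have /null_content_dominatesP := @normal_prob_dominates R 0 1.
apply => //; exact: lebesgue_measure_set1.
Qed.

(** For s = 0 the affine map is constant and its image law is the Dirac mass at m, so the degenerate
    and the proper case share one formula. *)
Lemma gaussian_law_affine (R : realType) (m s : R) (A : set R) :
  0 <= s -> measurable A ->
  gaussian_law m s A = std_normal R ((fun y => m + s * y) @^-1` A).
Proof.
rewrite le_eqVlt /gaussian_law => /predU1P[<-|s0] mA; last first.
  by rewrite gt_eqF// std_normalE; exact: normal_prob_affine.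
rewrite eqxx diracE; under eq_fun do rewrite mul0r addr0.
have [Am|Am] := pselect (A m).
  rewrite mem_set// (_ : _ @^-1` _ = setT) ?probability_setT//.
  by apply/seteqP; split.
rewrite memNset// (_ : _ @^-1` _ = set0) ?measure0//.
by apply/seteqP; split.
Qed.

(** [fine] makes this a real number in any case; it is identified with a finite expectation only in
    [centered_gaussian_law], once integrability of the identity has been derived. *)
Definition std_mean (R : realType) : R := fine (\int[std_normal R]_y y%:E)%E.

(** Kept in the extended reals: only positivity is established, and the value +oo is a separate case
    in [centered_gaussian_eq_law]. *)
Definition std_variance (R : realType) : \bar R :=
  (\int[std_normal R]_y ((y - std_mean R) ^+ 2)%:E)%E.

(** A zero variance would give y = [std_mean] almost surely; as points are null, the whole line
    would be null, against total mass 1. *)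
Lemma std_variance_gt0 (R : realType) : (0 < std_variance R)%E.
Proof.
have var_ge0 : (0 <= std_variance R)%E.
  by apply: integral_ge0 => y _; rewrite lee_fin sqr_ge0.
rewrite lt_def var_ge0 andbT; apply/negP => /eqP var0.
have mf : measurable_fun [set: R] (fun y => ((y - std_mean R) ^+ 2)%:E).
  apply/measurable_EFinP/measurable_funX.
  by apply: measurable_funB.
have /ae_eq_integral_abs : measurable [set: R] by [].
move=> /(_ R (std_normal R) _ mf) [+ _].
have -> : (\int[std_normal R]_y `|((y - std_mean R) ^+ 2)%:E| = 0)%E.
  rewrite -[RHS]var0; apply: eq_integral => y _.
  by rewrite gee0_abs// lee_fin sqr_ge0.
move=> /(_ erefl)[S [mS S0 SP]].
have : (std_normal R setT <= std_normal R (S `|` [set std_mean R]))%E.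
  apply: le_measure; rewrite ?inE//; first exact: measurableU.
  move=> y _; have [->|yk] := eqVneq y (std_mean R); [by right|left].
  apply: SP => /= /(_ Logic.I)/eqP; rewrite eqe sqrf_eq0 subr_eq0.
  by rewrite (negbTE yk).
rewrite null_set_setU//; [|exact: std_normal_set1].
by rewrite probability_setT lee_fin ler10.
Qed.

(** * Centered Gaussian variables: the variance determines the law *)

Section gaussian_rv_law.
Context (d : measure_display) (T : measurableType d) (R : realType)
  (P : probability T R).
Implicit Types X Y : {RV P >-> R}.

(** The condition of mean zero eliminates [m] from the affine map, leaving [s] as the only
    parameter. *)
Lemma centered_gaussian_law X :
    gaussian_rv P X -> (X : T -> R) \in Lfun P 1 -> 'E_P[X]%E = 0%E ->
  exists s : R, [/\ 0 <= s,
    forall A : set R, measurable A -> distribution P X A =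
      std_normal R ((fun y => s * (y - std_mean R)) @^-1` A) &
    ('V_P[X] = (s ^+ 2)%:E * std_variance R)%E].
Proof.
move=> [m [s [s0 XE]]] X1 EX0.
pose F := mfun_Sub (mem_set (measurable_affine m s)).
have lawX (A : set R) : measurable A ->
    distribution P X A = distribution (std_normal R) F A.
  by move=> mA; rewrite XE// gaussian_law_affine.
have mid : measurable_fun [set: R] (fun x : R => x%:E).
  exact/measurable_EFinP.
(* Being stated for nonnegative integrands, this can derive the integrability of [F] from that of
   [X], and later compute the variance. *)
have transfer (f : R -> R) : measurable_fun setT f -> (forall x, 0 <= f x) ->
    (\int[P]_w (f (X w))%:E = \int[std_normal R]_y (f (F y))%:E)%E.
  move=> mf f0.
  have mEf : measurable_fun setT (EFin \o f) by exact/measurable_EFinP.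
  have Ef0 x : (0 <= (EFin \o f) x)%E by rewrite lee_fin.
  rewrite -[LHS](ge0_integral_distribution X mEf Ef0).
  rewrite -[RHS](ge0_integral_distribution F mEf Ef0).
  apply: eq_measure_integral => A mA _; exact: (lawX A mA).
have F1 : (F : R -> R) \in Lfun (std_normal R) 1.
  apply/Lfun1_integrable/integrableP; split; first exact/measurable_EFinP.
  have /Lfun1_integrable/integrableP[_] := X1.
  by rewrite (transfer (fun x => `|x|)).
have EF : 'E_(std_normal R)[F]%E = 0%E.
  rewrite -EX0 unlock.
  have /Lfun1_integrable iX := X1; have /Lfun1_integrable iF := F1.
  rewrite -(integral_distribution mid iX) -(integral_distribution mid iF).
  apply: eq_measure_integral => A mA _; exact: (esym (lawX A mA)).
(* If s = 0, then [F] is the constant m, so m = 0. If s > 0, the identity is (F - m) / s, hence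
   integrable, and linearity gives m + s [std_mean] = 0. *)
have ms : m = - s * std_mean R.
  move: s0; rewrite le_eqVlt => /predU1P[s0|s0].
    move: EF; rewrite (_ : (F : R -> R) = cst m).
      by rewrite expectation_cst -s0 oppr0 mul0r => -[].
    by apply/funext => y /=; rewrite -s0 mul0r addr0.
  have id1 : (idfun : R -> R) \in Lfun (std_normal R) 1.
    rewrite (_ : idfun = s^-1 \o* ((F : R -> R) \- cst m)).
      by rewrite Lfun_scale// rpredB// Lfun_cst.
    by apply/funext => y /=; field; rewrite gt_eqF.
  move: EF; rewrite (_ : (F : R -> R) = cst m \+ s \o* idfun); last first.
    by apply/funext => y /=; rewrite mulrC.
  rewrite expectationD ?Lfun_cst ?Lfun_scale// expectation_cst expectationZl//.
  rewrite -[X in (_ * X)%E]fineK ?expectation_fin_num//.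
  have -> : fine 'E_(std_normal R)[idfun]%E = std_mean R by rewrite unlock.
  by rewrite -EFinM -EFinD => -[] /eqP; rewrite addr_eq0 mulNr => /eqP.
exists s; split => // [A mA|].
  rewrite lawX// /distribution /pushforward; congr (std_normal R _).
  by apply/seteqP; split=> y /=; rewrite ms mulNr mulrBr addrC.
rewrite /variance unlock EX0 /= unlock.
transitivity (\int[P]_w ((X w) ^+ 2)%:E)%E.
  by apply: eq_integral => w _ /=; rewrite !fctE/= subr0 expr2.
have msqr : measurable_fun [set: R] (fun y => ((y - std_mean R) ^+ 2)%:E).
  by apply/measurable_EFinP/measurable_funX; exact: measurable_funB.
have sqr0 (x : R) : (0 <= (x ^+ 2)%:E)%E by rewrite lee_fin sqr_ge0.
rewrite (transfer (fun x => x ^+ 2)) => [||x];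
  [|exact: measurable_funX|exact: sqr_ge0].
rewrite -ge0_integralZl//; apply: eq_integral => y _.
by rewrite -EFinM; congr EFin; rewrite /= ms; ring.
Qed.

Lemma centered_gaussian_eq_law X Y :
    gaussian_rv P X -> gaussian_rv P Y ->
    (X : T -> R) \in Lfun P 1 -> (Y : T -> R) \in Lfun P 1 ->
    'E_P[X]%E = 0%E -> 'E_P[Y]%E = 0%E ->
    'V_P[X]%E \is a fin_num -> 'V_P[X]%E = 'V_P[Y]%E ->
  forall A : set R, measurable A -> distribution P X A = distribution P Y A.
Proof.
move=> gX gY X1 Y1 EX EY finV VXY A mA.
have [s [s0 -> // Vs]] := centered_gaussian_law gX X1 EX.
have [t [t0 -> // Vt]] := centered_gaussian_law gY Y1 EY.
suff -> : s = t by [].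
have v0 := std_variance_gt0 R.
move: finV; rewrite VXY Vt => finV; move: VXY; rewrite Vs Vt.
move: finV v0; case: (std_variance R) => [r _| |//].
  rewrite lte_fin => r0 [] /(mulIf (lt0r_neq0 r0))/eqP.
  by rewrite eqrXn2// => /eqP.
(* Case of [std_variance] equal to +oo: finiteness forces t = 0, and then equality of the variances
   forces s = 0. *)
have [->|tn0] := eqVneq t 0; last first.
  by rewrite gt0_muley// lte_fin exprn_even_gt0.
have [//|sn0 _ _] := eqVneq s 0.
by rewrite expr0n/= mul0e gt0_muley// lte_fin exprn_even_gt0.
Qed.

End gaussian_rv_law.

(** * Moments of linear combinations *)

Section linear_combination.
Context (d : measure_display) (T : measurableType d) (R : realType)
  (P : probability T R) (J : Type) (c : J -> R) (Z : J -> T -> R)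
  (Z2 : forall i, Z i \in Lfun P 2%:E).

(** Indexing by a sequence lets the two-term rules for expectation and covariance extend by
    induction on it. *)
Definition lincomb (s : seq J) (w : T) : R := \sum_(i <- s) c i * Z i w.

Let lincomb_cons i s : lincomb (i :: s) = c i \o* Z i \+ lincomb s.
Proof. by apply/funext => w; rewrite /lincomb big_cons/= mulrC. Qed.

Let Lfun21 (f : T -> R) : f \in Lfun P 2%:E -> f \in Lfun P 1.
Proof. by apply: Lfun_subset12; rewrite fin_num_measure. Qed.

Lemma Lfun_lincomb s : lincomb s \in Lfun P 2%:E.
Proof.
elim: s => [|i s IH].
  rewrite (_ : lincomb _ = cst 0); first exact: Lfun_cst.
  by apply/funext => w; rewrite /lincomb big_nil.
by rewrite lincomb_cons rpredD ?lee1n//= => _; rewrite Lfun_scale// ler1n.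
Qed.

Lemma expectation_lincomb s :
  ('E_P[lincomb s] = \sum_(i <- s) (c i)%:E * 'E_P[Z i])%E.
Proof.
elim: s => [|i s IH].
  rewrite big_nil (_ : lincomb _ = cst 0) ?expectation_cst//.
  by apply/funext => w; rewrite /lincomb big_nil.
have cZ1 : c i \o* Z i \in Lfun P 1 by rewrite Lfun_scale// Lfun21.
have l1 := Lfun21 (Lfun_lincomb s).
by rewrite big_cons -IH lincomb_cons expectationD// expectationZl// Lfun21.
Qed.

Lemma covariance_lincombl s (Y : T -> R) : Y \in Lfun P 2%:E ->
  (covariance P (lincomb s) Y =
   \sum_(i <- s) (c i)%:E * covariance P (Z i) Y)%E.
Proof.
move=> Y2; elim: s => [|i s IH].
  rewrite big_nil (_ : lincomb _ = cst 0) ?covariance_cst_l//.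
  by apply/funext => w; rewrite /lincomb big_nil.
have cZ2 : c i \o* Z i \in Lfun P 2%:E by rewrite Lfun_scale// ler1n.
have l2 := Lfun_lincomb s.
rewrite big_cons -IH lincomb_cons covarianceDl// covarianceZl//.
- exact: Lfun21.
- exact: Lfun21.
- exact: Lfun2_mul_Lfun1.
Qed.

Lemma variance_lincomb s :
  ('V_P[lincomb s] = \sum_(i <- s) (c i)%:E *
     \sum_(j <- s) (c j)%:E * covariance P (Z i) (Z j))%E.
Proof.
rewrite /variance covariance_lincombl ?Lfun_lincomb//.
apply: eq_bigr => i _; congr (_ * _)%E.
rewrite covarianceC covariance_lincombl//.
by apply: eq_bigr => j _; rewrite covarianceC.
Qed.

End linear_combination.

(** With mean 0 the variance is the integral of X^2, so its finiteness is square integrability, the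
    hypothesis under which covariance is expanded bilinearly. *)
Lemma centered_Lfun2 (d : measure_display) (T : measurableType d) (R : realType)
    (P : probability T R) (X : {RV P >-> R}) :
  'E_P[X]%E = 0%E -> 'V_P[X]%E \is a fin_num -> (X : T -> R) \in Lfun P 2%:E.
Proof.
move=> EX; rewrite /variance unlock EX/= unlock => finV.
rewrite inE; apply/andP; split; rewrite inE//=; rewrite /finite_norm.
rewrite unlock; apply: poweR_lty.
rewrite (_ : integral _ _ _ =
    \int[P]_w (((X \- cst 0) * (X \- cst 0))%R w)%:E)%E ?ltey_eq ?finV//.
apply: eq_integral => w _ /=.
by rewrite !fctE/= subr0 -expr2 powR_mulrn// real_normK// num_real.
Qed.

(** * Centered Gaussian processes with equal covariances *)

Section gaussian_process_fdd.
Context (d : measure_display) (T : measurableType d) (R : realType)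
  (P : probability T R) (I : Type).
Implicit Types X Y : I -> {RV P >-> R}.

Lemma mfun_lincomb n (c : 'I_n -> R) (Z : 'I_n -> {RV P >-> R}) :
  (\sum_(i < n) c i *: Z i : {RV P >-> R}) =
  lincomb c (fun i => Z i : T -> R) (index_enum 'I_n) :> (T -> R).
Proof.
apply/funext => w; rewrite /lincomb.
by elim/big_ind2 : _ => // f a g b /= <- <-.
Qed.

(** A plane wave depends on x only through c . x, so its integral under the joint law is one under
    the law on the line of the corresponding linear combination. *)
Lemma integral_plane_wave_joint X n (t : 'I_n -> I) (c : 'I_n -> R) (e : R) :
  (\int[distribution P (joint P X t)]_x (plane_wave c e x)%:E =
   \int[distribution P (\sum_(i < n) c i *: X (t i) : {RV P >-> R})%R]_y
     (cos (y + e))%:E)%E.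
Proof.
have mcos : measurable_fun [set: R] (fun y => cos (y + e)).
  apply: measurableT_comp; last exact: measurable_funD.
  by apply: continuous_measurable_fun; exact: continuous_cos.
have bnd (f : T -> R) : measurable_fun setT (fun w => cos (f w)) ->
    P.-integrable setT (fun w => (cos (f w))%:E).
  move=> mf; apply: measurable_bounded_integrable => //.
    by rewrite ltey_eq fin_num_measure.
  exists 1; split=> [|N N1 w _]; first exact: num_real.
  by rewrite /= (le_trans (cos_norm_le1 _))// ltW.
have mwave := measurable_trig_closure (trig_wave c e).
rewrite integral_distribution; last 2 first.
- by apply/measurable_EFinP; exact: mwave.
- apply: bnd; exact: (measurableT_comp mwave (measurable_funP (joint P X t))).
rewrite integral_distribution; last 2 first.
- exact/measurable_EFinP.
- apply: bnd; exact: (measurableT_comp mcos (measurable_funP _)).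
apply: eq_integral => w _ /=; congr (cos (_ + e))%:E.
rewrite mfun_lincomb; apply: eq_bigr => i _.
by rewrite tnth_mktuple.
Qed.

(** It suffices to compare the laws of linear combinations. Both are centered Gaussian, and their
    variances are the same quadratic form in the covariances. *)
Lemma gaussian_process_same_fdd X Y :
    gaussian_process P X -> gaussian_process P Y ->
    centered P X -> centered P Y ->
    (forall t s, covariance P (X t) (X s) \is a fin_num) ->
    (forall t s, covariance P (X t) (X s) = covariance P (Y t) (Y s)) ->
  same_fdd P X Y.
Proof.
move=> gX gY cX cY fin covXY n t.
apply: eq_probability_plane_wave => c e; rewrite !integral_plane_wave_joint.
apply: eq_measure_integral => A mA _.
have X2 i : (X (t i) : T -> R) \in Lfun P 2%:E.
  by apply: centered_Lfun2; [exact: cX|exact: fin].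
have Y2 i : (Y (t i) : T -> R) \in Lfun P 2%:E.
  by apply: centered_Lfun2; [exact: cY|rewrite /variance -covXY; exact: fin].
have L21 (f : T -> R) : f \in Lfun P 2%:E -> f \in Lfun P 1.
  by apply: Lfun_subset12; rewrite fin_num_measure.
apply: centered_gaussian_eq_law => //; rewrite ?mfun_lincomb.
- by apply: L21; exact: Lfun_lincomb.
- by apply: L21; exact: Lfun_lincomb.
- by rewrite expectation_lincomb// big1// => i _; rewrite cX mule0.
- by rewrite expectation_lincomb// big1// => i _; rewrite cY mule0.
- by rewrite variance_fin_num// Lfun_lincomb.
- rewrite !variance_lincomb//.
  apply: eq_bigr => i _; congr (_ * _)%E.
  by apply: eq_bigr => j _; rewrite covXY.
Qed.

End gaussian_process_fdd.

(** * Processes of the form a B_u + b B_v *)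

Section two_term_combination.
Context (d : measure_display) (T : measurableType d) (R : realType)
  (P : probability T R) (J I : Type) (B : J -> {RV P >-> R})
  (u v : I -> J) (a b : R).
(** With index maps and coefficients left abstract, both Z_(ht) and h^H Z_t are instances. *)
Let Z (t : I) : {RV P >-> R} := a *: B (u t) + b *: B (v t).

Lemma gaussian_process_two_terms : gaussian_process P B -> gaussian_process P Z.
Proof.
move=> gB n t c.
(* A combination of n values of [Z] is one of 2n values of [B]: the first n indices carry [u] and
   [a], the last n carry [v] and [b]. Times may coincide, as [gaussian_process] permits. *)
pose t' (j : 'I_(n + n)) :=
  match fintype.split j with inl i => u (t i) | inr i => v (t i) end.
pose c' (j : 'I_(n + n)) :=
  match fintype.split j with inl i => c i * a | inr i => c i * b end.
suff -> : (\sum_(i < n) c i *: Z (t i) : {RV P >-> R}) =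
    \sum_(j < n + n) c' j *: B (t' j) by exact: gB.
rewrite big_split_ord/= -big_split/=; apply: eq_bigr => i _.
rewrite /c' /t' -/(unsplit (inl i)) -/(unsplit (inr i)) !unsplitK.
by rewrite scalerDr !scalerA.
Qed.

Lemma covariance_two_terms (K : J -> J -> R) :
    centered P B -> (forall t s, covariance P (B t) (B s) = (K t s)%:E) ->
  forall t s, covariance P (Z t) (Z s) =
    (a ^+ 2 * K (u t) (u s) + a * b * K (u t) (v s) +
     (b * a * K (v t) (u s) + b ^+ 2 * K (v t) (v s)))%:E.
Proof.
move=> cB covB t s.
have B2 j : (B j : T -> R) \in Lfun P 2%:E.
  by apply: centered_Lfun2; [exact: cB|rewrite /variance covB].
have L21 (f : T -> R) : f \in Lfun P 2%:E -> f \in Lfun P 1.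
  by apply: Lfun_subset12; rewrite fin_num_measure.
have scal2 (r : R) j : r \o* B j \in Lfun P 2%:E by rewrite Lfun_scale// ler1n.
pose f r := a \o* B (u r) \+ b \o* B (v r).
have ZE r : (Z r : T -> R) = f r.
  by apply/funext => w; rewrite /f /= !(mulrC (B _ w)).
have f2 r : f r \in Lfun P 2%:E by rewrite rpredD ?lee1n//= => _.
have covZ (r r' : R) j k :
    covariance P (r \o* B j) (r' \o* B k) = (r * r' * K j k)%:E.
  have BB := Lfun2_mul_Lfun1 (B2 j) (B2 k).
  have BrB := Lfun2_mul_Lfun1 (B2 j) (scal2 r' k).
  rewrite covarianceZl//; [|exact: L21|exact: L21].
  rewrite covarianceZr ?covB//; [|exact: L21|exact: L21].
  by rewrite -!EFinM mulrA.
transitivity (covariance P (f t) (f s)).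
  by congr (covariance P _ _); exact: ZE.
rewrite {1}/f covarianceDl//.
rewrite (covarianceDr (Y := a \o* B (u s)) (Z := b \o* B (v s)))//.
rewrite (covarianceDr (Y := a \o* B (u s)) (Z := b \o* B (v s)))//.
by rewrite !covZ -!EFinD.
Qed.

Lemma centered_two_terms :
  centered P B -> (forall t, 'V_P[B t]%E \is a fin_num) -> centered P Z.
Proof.
move=> cB fB t.
have B1 j : (B j : T -> R) \in Lfun P 1.
  apply: Lfun_subset12; first by rewrite fin_num_measure.
  by apply: centered_Lfun2; [exact: cB|exact: fB].
have scal1 (r : R) j : r \o* B j \in Lfun P 1 by rewrite Lfun_scale.
rewrite (_ : (Z t : T -> R) = a \o* B (u t) \+ b \o* B (v t)).
  by rewrite expectationD// !expectationZl// !cB !mule0 adde0.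
by apply/funext => w; rewrite /= !(mulrC (B _ w)).
Qed.

End two_term_combination.

(** * Scaling of the covariance *)

Theorem lemma2 (R : realType) (d : measure_display) (Omega : measurableType d)
  (P : probability Omega R) (H a b : R) (B : R -> {RV P >-> R}) :
  0 < H < 1 ->
  (a, b) <> (0, 0) ->
  fractional_brownian_motion P H B ->
  self_similar P (gfBm P a b B).
Proof.
move=> /andP[H0 _] _ [gB cB covB]; exists H => // h.
have h0 : 0 < h%:num by [].
pose K (t s : R) :=
  2^-1 * (`|s| `^ (2 * H) + `|t| `^ (2 * H) - `|t - s| `^ (2 * H)).
(* The kernel is homogeneous of degree 2H, which is what makes H the exponent. *)
have KZ t s : K (h%:num * t) (h%:num * s) = (h%:num `^ H) ^+ 2 * K t s.
  have -> : (h%:num `^ H) ^+ 2 = h%:num `^ (2 * H).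
    by rewrite -powR_mulrn ?powR_ge0// -powRrM mulrC.
  rewrite /K -mulrBr !normrM (gtr0_norm h0) !powRM ?normr_ge0 ?ltW//.
  by ring.
have finV t : 'V_P[B t]%E \is a fin_num by rewrite /variance covB.
(* Absorbing h^H into the coefficients makes the rescaled process a two-term combination too. *)
have YE : (fun t => h%:num `^ H *: gfBm P a b B t) =
    (fun t => (h%:num `^ H * a) *: B t%:num +
              (h%:num `^ H * b) *: B (- t%:num)).
  by apply/funext => t; rewrite /gfBm scalerDr !scalerA.
have covX := covariance_two_terms (fun r : {nonneg R} => h%:num * r%:num)
  (fun r => - (h%:num * r%:num)) a b cB covB.
have covY := covariance_two_terms (fun r : {nonneg R} => r%:num)
  (fun r => - r%:num) (h%:num `^ H * a) (h%:num `^ H * b) cB covB.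
rewrite YE /gfBm; apply: gaussian_process_same_fdd.
- exact: gaussian_process_two_terms.
- exact: gaussian_process_two_terms.
- exact: centered_two_terms.
- exact: centered_two_terms.
- by move=> t s; rewrite [X in X \is a fin_num](covX t s).
- move=> t s; apply: (etrans (covX t s)); apply: (etrans _ (esym (covY t s))).
  (* Rewriting -(h t) as h (-t) lets homogeneity apply to the reflected times as well. *)
  by rewrite -!/(K _ _) -!mulrN !KZ; congr EFin; ring.
Qed.
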